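(* Let $G(\mathcal{Q})$ be a $k$-huge graphical complex of groups over $\mathcal{Q}$ for $k \geq 6$ and let $G$ be its fundamental group. Then the Basic Construction $D(G, C(|\mathcal{Q}|))$, with its natural structure of a graphical complex, satisfies the $C(k)$-condition.
   Context: A poset $\mathcal{Q}$ is $1$-dimensional if its geometric realisation $|\mathcal{Q}|$ (the simplicial complex of finite chains of $\mathcal{Q}$) is a graph. Elements of $\mathcal{Q}$ are called vertices; a vertex is big if it is strictly larger than some other vertex and small if it is strictly smaller than some other vertex, so $|\mathcal{Q}|$ is a bipartite simplicial graph whose edges join a small vertex $v$ to a big vertex $w$ with $v<w$. Standing assumptions: $\mathcal{Q}$ is finite, $1$-dimensional, $|\mathcal{Q}|$ is connected, $\mathcal{Q}$ has more than one vertex, no vertex of valence one and no disconnecting vertex (a vertex whose removal disconnects $|\mathcal{Q}|$). A graphical complex of groups $G(\mathcal{Q})$ over $\mathcal{Q}$ consists of non-trivial finite groups $G_v$, $v\in\mathcal{Q}$ (the local groups), and injective, non-surjective homomorphisms $\psi_{vw}\colon G_v\to G_w$ for every pair $v<w$, such that $\psi_{v_1w}(G_{v_1})\cap\psi_{v_2w}(G_{v_2})=\{e\}$ for all distinct $v_1,v_2<w$. Its fundamental group $G$ is the direct limit (colimit) of the system $(\{G_v\},\{\psi_{vw}\})$. $\mathcal{Q}$, and $G(\mathcal{Q})$, is $k$-huge if every embedded cycle in $|\mathcal{Q}|$ contains at least $k$ small vertices (equivalently, the girth of $|\mathcal{Q}|$ is at least $2k$). $C(|\mathcal{Q}|)$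 is the simplicial cone over $|\mathcal{Q}|$ with cone vertex $c$. For a small vertex $v$, $|\mathcal{Q}_{\geq v}|$ is the union of the edges of $|\mathcal{Q}|$ incident to $v$. The Basic Construction is $D(G,C(|\mathcal{Q}|))=G\times C(|\mathcal{Q}|)/\sim$, where $(g_1,x_1)\sim(g_2,x_2)$ iff $x_1=x_2$ and: either $(g_1,x_1)=(g_2,x_2)$, or $x_1=w$ for a big vertex $w$ and $g_1^{-1}g_2\in G_w$, or $x_1\in|\mathcal{Q}_{\geq v}|$ for a small vertex $v$ and $g_1^{-1}g_2\in G_v$ (local groups are identified with their images in $G$). Graphical complexes. A graph is a $1$-dimensional simplicial complex; an immersion is a locally injective simplicial map. Let $\Theta$ be a graph, $\Gamma=\bigsqcup_{i\in I}\Gamma_i$ a disjoint union of countably many finite graphs and $\phi=\sqcup\phi_i\colon\Gamma\to\Theta$ an immersion. The graphical complex $X=\Theta\cup_\phi\bigsqcup_{i\in I}C(\Gamma_i)$ is obtained by gluing each cone $C(\Gamma_i)$ to $\Theta$ along $\phi_i$. The images of the $C(\Gamma_i)$ are the cone-cells. A piece is an immersed path $P\to\Theta$ with two factorisations $P\to\Gamma_i\to\Theta$ and $P\to\Gamma_j\to\Theta$ such that there is no isomorphism $\Gamma_j\to\Gamma_i$ compatible with both the maps from $P$ and the maps to $\Theta$. $X$ satisfies the $C(k)$-condition if no embedded cycle $C\to\Theta$ which factors through some $\Gamma_i\to\Theta$ is a concatenation of fewer than $k$ pieces. Natural graphical structure of $D(G,C(|\mathcal{Q}|))$: $\Theta=D(G,|\mathcal{Q}|)=\{[g,x]: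 g\in G,\ x\in|\mathcal{Q}|\}$, and for each $g\in G$ there is a cone $\{g\}\times C(|\mathcal{Q}|)$ attached along the map $\{g\}\times|\mathcal{Q}|\to[g,|\mathcal{Q}|]\subset D(G,|\mathcal{Q}|)$. *)

(* Defs.v *)
From HB Require Import structures.
From mathcomp Require Import all_boot all_order all_fingroup.
From mathcomp Require Import zmodp generic_quotient.
From mathcomp Require Import all_classical.

Set Implicit Arguments.
Unset Strict Implicit.
Unset Printing Implicit Defensive.

Local Open Scope group_scope.
Local Open Scope quotient_scope.

Record sgraph := SGraph {
  vertex :> Type;
  adj : vertex -> vertex -> Prop;
  adj_sym : forall x y, adj x y -> adj y x;
  adj_irrefl : forall x, ~ adj x x
}.

(* A simplicial map that collapses no edge. *)
Definition graph_hom (A B : sgraph) (f : A -> B) : Prop :=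
  forall x y, adj x y -> adj (f x) (f y).

(* A locally injective map collapses no edge, hence [graph_hom]; on the star
   of [x] it remains to separate the neighbours of [x]. *)
Definition immersion (A B : sgraph) (f : A -> B) : Prop :=
  graph_hom f /\ forall x y z, adj x y -> adj x z -> f y = f z -> y = z.

Definition graph_iso (A B : sgraph) (f : A -> B) : Prop :=
  bijective f /\ forall x y, adj x y <-> adj (f x) (f y).

Definition path_adj n (i j : 'I_n.+1) : Prop := i.+1 = j \/ j.+1 = i.

Lemma path_adj_sym n (i j : 'I_n.+1) : path_adj i j -> path_adj j i.
Proof. by case=> h; [right | left]. Qed.

Lemma path_adj_irrefl n (i : 'I_n.+1) : ~ path_adj i i.
Proof. by case=> /eqP; rewrite eqn_leq ltnn. Qed.

(* The path with [n] edges. *)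
Definition path_graph n : sgraph :=
  SGraph (@path_adj_sym n) (@path_adj_irrefl n).

Definition cycle_adj n (i j : 'I_n.+3) : Prop :=
  inZp i.+1 = j \/ inZp j.+1 = i.

Lemma cycle_adj_sym n (i j : 'I_n.+3) : cycle_adj i j -> cycle_adj j i.
Proof. by case=> h; [right | left]. Qed.

Lemma cycle_adj_irrefl n (i : 'I_n.+3) : ~ cycle_adj i i.
Proof.
suff h : inZp i.+1 <> i by case.
move=> /(congr1 val) /=; have := ltn_ord i; rewrite ltnS leq_eqVlt.
case/orP=> [/eqP -> | ii]; first by rewrite modnn.
by rewrite modn_small // => /eqP; rewrite eqn_leq ltnn.
Qed.

(* The cycle with [n + 3] edges. *)
Definition cycle_graph n : sgraph :=
  SGraph (@cycle_adj_sym n) (@cycle_adj_irrefl n).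

Definition embedded_cycle (A : sgraph) n (c : cycle_graph n -> A) : Prop :=
  graph_hom c /\ injective c.

(* The complex obtained from [gc_base] by attaching the cone over [gc_cone i]
   along [gc_map i], for each [i]. *)
Record graphical_complex := GraphicalComplex {
  gc_base : sgraph;
  gc_index : Type;
  gc_countable : countable [set: gc_index]%classic;
  gc_cone : gc_index -> sgraph;
  gc_finite : forall i, finite_set [set: gc_cone i]%classic;
  gc_map : forall i, gc_cone i -> gc_base;
  gc_immersion : forall i, immersion (@gc_map i)
}.

Definition piece (X : graphical_complex) n (p : path_graph n -> gc_base X) :
    Prop :=
  immersion p /\
  exists (i j : gc_index X)
    (qi : path_graph n -> gc_cone i) (qj : path_graph n -> gc_cone j),
    [/\ graph_hom qi, graph_hom qj,
        forall t, gc_map (qi t) = p t,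
        forall t, gc_map (qj t) = p t
      & ~ exists f : gc_cone j -> gc_cone i,
          [/\ graph_iso f,
              forall t, f (qj t) = qi t
            & forall x, gc_map (f x) = gc_map x]].

(* The restriction of [c] to the arc of [l] edges starting at [s]; indices are
   taken modulo [n + 3]. *)
Definition arc_path (A : sgraph) n (c : cycle_graph n -> A) (s l : nat) :
    path_graph l -> A :=
  fun t => c (inZp (s + t)).

(* The base point [s] is arbitrary, and the [j]-th piece has [nth 0 ls j]
   edges. *)
Definition concatenation_of_pieces (X : graphical_complex) n
    (c : cycle_graph n -> gc_base X) (m : nat) : Prop :=
  exists (s : nat) (ls : seq nat),
    [/\ size ls = m, sumn ls = n.+3
      & forall j, j < m ->
          piece (arc_path c (s + sumn (take j ls)) (l := nth 0 ls j))].

Definition C_condition (k : nat) (X : graphical_complex) : Prop :=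
  forall n (c : cycle_graph n -> gc_base X),
    embedded_cycle c ->
    (exists (i : gc_index X) (ci : cycle_graph n -> gc_cone i),
        graph_hom ci /\ forall t, gc_map (ci t) = c t) ->
    ~ exists m, m < k /\ concatenation_of_pieces c m.

Section Poset.
Variables (d : Order.disp_t) (Q : finPOrderType d).
Implicit Types (x y v w : Q) (A : {set Q}).

(* Chains are the simplices of the geometric realisation. *)
Definition chain A : bool := [forall x in A, forall y in A, (x >=< y)%O].

Definition big w : bool := [exists v, (v < w)%O].
Definition small v : bool := [exists w, (v < w)%O].

Definition linked x y : bool := (x < y)%O || (y < x)%O.

Lemma linked_sym x y : linked x y -> linked y x.
Proof. by rewrite /linked orbC. Qed.

Lemma linked_irrefl x : ~ linked x x.
Proof. by rewrite /linked Order.POrderTheory.ltxx. Qed.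

(* The 1-skeleton of the geometric realisation; all of it when the poset is
   1-dimensional. *)
Definition order_graph : sgraph := SGraph linked_sym linked_irrefl.

Definition linked_off x y z : bool := [&& y != x, z != x & linked y z].

Record graphical_poset : Prop := {
  gp_dim1 : forall A, chain A -> #|A| <= 2;
  gp_connected : forall x y, connect linked x y;
  gp_nontrivial : 1%N < #|Q|;
  gp_valence : forall x, #|[set y | linked x y]| != 1%N;
  gp_no_cut : forall x y z,
    y != x -> z != x -> connect (linked_off x) y z
}.

Definition huge (k : nat) : Prop :=
  forall n (c : cycle_graph n -> order_graph),
    embedded_cycle c -> k <= #|[set c i | i : 'I_n.+3 & small (c i)]|.

End Poset.

Arguments order_graph {d} Q.
Arguments graphical_poset {d} Q.
Arguments huge {d} Q k.

(* No compatibility is required of [cg_map], since a 1-dimensional poset has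
   no chain [u < v < w]. *)
Record complex_of_groups (d : Order.disp_t) (Q : finPOrderType d) :=
  ComplexOfGroups {
    cg_group :> Q -> finGroupType;
    cg_map : forall v w : Q, (v < w)%O ->
      {multiplicative cg_group v -> cg_group w};
    cg_nontrivial : forall v, 1%N < #|cg_group v|;
    cg_inj : forall v w (vw : (v < w)%O), injective (cg_map vw);
    cg_nonsurj : forall v w (vw : (v < w)%O),
      ~ (forall b, exists a, cg_map vw a = b);
    cg_disjoint : forall v1 v2 w (v1w : (v1 < w)%O) (v2w : (v2 < w)%O),
      v1 != v2 ->
      (cg_map v1w @: [set: cg_group v1]) :&: (cg_map v2w @: [set: cg_group v2])
        = [set 1]
  }.

(* A colimit of the system of local groups in the category of groups. *)
Record fundamental_group (d : Order.disp_t) (Q : finPOrderType d)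
    (A : complex_of_groups Q) := FundamentalGroup {
  fg_group :> groupType;
  fg_in : forall v : Q, {multiplicative A v -> fg_group};
  fg_compat : forall (v w : Q) (vw : (v < w)%O) (a : A v),
    fg_in w (cg_map A vw a) = fg_in v a;
  fg_universal : forall (H : groupType)
      (f : forall v, {multiplicative A v -> H}),
    (forall (v w : Q) (vw : (v < w)%O) (a : A v),
        f w (cg_map A vw a) = f v a) ->
    exists h : {multiplicative fg_group -> H},
      (forall v a, h (fg_in v a) = f v a) /\
      (forall h' : {multiplicative fg_group -> H},
          (forall v a, h' (fg_in v a) = f v a) -> h' =1 h)
}.

Section Countability.
Variables (d : Order.disp_t) (Q : finPOrderType d) (A : complex_of_groups Q).
Variable G : fundamental_group A.

Lemma fg_in1 v : fg_in G v 1 = 1.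
Proof. by apply: (mulgI (fg_in G v 1)); rewrite -gmulfM !mulg1. Qed.

Lemma fg_inV v (a : A v) : fg_in G v a^-1 = (fg_in G v a)^-1.
Proof. by apply: (mulgI (fg_in G v a)); rewrite -gmulfM !mulgV fg_in1. Qed.

Definition fg_word (s : seq {v : Q & A v}) : G :=
  foldr (fun a g => fg_in G (tag a) (tagged a) * g) 1 s.

Lemma fg_word_cat s t : fg_word (s ++ t) = fg_word s * fg_word t.
Proof. by elim: s => [|a s IH] /=; rewrite ?mul1g // IH mulgA. Qed.

Definition fg_gen : {pred G} := fun g => `[< exists s, fg_word s = g >].

Lemma fg_gen_closed : group_closed fg_gen.
Proof.
split; first by apply/asboolP; exists [::].
move=> x y /asboolP[s <-] /asboolP[t <-] {x y}.
have [t' t'E] : exists t', fg_word t' = (fg_word t)^-1.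
  elim: t => [|a t [t' IH]]; first by exists [::]; rewrite /= invg1.
  exists (t' ++ [:: Tagged (fun v => A v : Type) (tagged a)^-1]).
  by rewrite fg_word_cat IH /= mulg1 fg_inV invgM.
by apply/asboolP; exists (s ++ t'); rewrite fg_word_cat t'E.
Qed.

Definition fg_sub := {g : G | g \in fg_gen}.
HB.instance Definition _ := SubChoice.on fg_sub.
HB.instance Definition _ :=
  SubChoice_isSubGroup.Build G fg_gen fg_sub fg_gen_closed.

Lemma fg_in_gen v (a : A v) : fg_in G v a \in fg_gen.
Proof.
by apply/asboolP; exists [:: Tagged (fun v => A v : Type) a]; rewrite /= mulg1.
Qed.

Definition fg_in_sub v (a : A v) : fg_sub :=
  exist (fun g => g \in fg_gen) _ (fg_in_gen a).

Lemma fg_in_subM v : {morph @fg_in_sub v : x y / x * y}.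
Proof. by move=> x y; apply: val_inj; rewrite valM /= gmulfM. Qed.
HB.instance Definition _ v :=
  isMultiplicative.Build (A v) fg_sub (@fg_in_sub v) (@fg_in_subM v).

HB.instance Definition _ :=
  isMultiplicative.Build fg_sub G (val : fg_sub -> G) (@valM _ _ _).

Lemma fg_generated (g : G) : exists s, fg_word s = g.
Proof.
have [|h [hE _]] := @fg_universal _ _ _ G _
    (fun v => (@fg_in_sub v : {multiplicative A v -> fg_sub})).
  by move=> v w vw a; apply: val_inj; rewrite /= fg_compat.
have [|i [_ iU]] := @fg_universal _ _ _ G _ (fun v => fg_in G v).
  by move=> v w vw a; rewrite fg_compat.
have hK : idfun g = val (h g).
  have -> : val (h g) = i g.
    by apply: (iU ((val : fg_sub -> G) \o h)) => v a; rewrite /= hE.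
  exact: (iU idfun).
by rewrite -[g]/(idfun g) hK; apply/asboolP/(valP (h g)).
Qed.

Lemma fg_countable : countable [set: G]%classic.
Proof.
have -> : [set: G]%classic = range fg_word.
  by apply/seteqP; split=> // g _; have [s <-] := fg_generated g; exists s.
exact: card_le_trans (card_image_le _ _) (countableP _).
Qed.

End Countability.

Section BasicConstruction.
Variables (d : Order.disp_t) (Q : finPOrderType d) (A : complex_of_groups Q).
Variable G : fundamental_group A.
Implicit Types (p q : G * {set Q}) (a b : G * Q).

Definition in_local (v : Q) (g : G) : Prop := exists a : A v, fg_in G v a = g.

(* A pair [(g, s)] stands for the points [(g, x)] with [x] in the open simplex
   of the realisation of [Q] spanned by the chain [s]; these points all behave
   alike under the relation, and [x] lies in the realisation of the elements
   above [v] iff [s] consists of such elements. Cone points are absent: a point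
   of the cone off its base is equivalent only to itself, so that
   D(G, C|Q|) is D(G, |Q|) with a cone attached along each [{g} * |Q|]. *)
Definition bc_eq p q : Prop :=
  p.2 = q.2 /\
  [\/ p.1 = q.1,
      exists w : Q, [/\ big w, p.2 = [set w] & in_local w (p.1^-1 * q.1)]
    | exists v : Q, [/\ small v, p.2 \subset [set x | (v <= x)%O]
                      & in_local v (p.1^-1 * q.1)]].

Definition bc_vertex_eq a b : Prop := bc_eq (a.1, [set a.2]) (b.1, [set b.2]).

Lemma in_local_le (v w : Q) g : (v <= w)%O -> in_local v g -> in_local w g.
Proof.
rewrite Order.POrderTheory.le_eqVlt => /predU1P[-> // | vw [x <-]].
by exists (cg_map A vw x); rewrite fg_compat.
Qed.

Lemma in_local1 v : in_local v 1.
Proof. by exists 1; rewrite fg_in1. Qed.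

Lemma in_localV v g : in_local v g -> in_local v g^-1.
Proof. by move=> [x <-]; exists x^-1; rewrite fg_inV. Qed.

Lemma in_localM v g h : in_local v g -> in_local v h -> in_local v (g * h).
Proof. by move=> [x <-] [y <-]; exists (x * y); rewrite gmulfM. Qed.

Lemma bc_vertex_eqE g h (x y : Q) : big x || small x ->
  bc_vertex_eq (g, x) (h, y) <-> x = y /\ in_local x (g^-1 * h).
Proof.
move=> bsx; rewrite /bc_vertex_eq /bc_eq /=.
split=> [[/set1_inj <- gh] | [<- gh]].
  split=> //; case: gh => [-> | [w [_ /set1_inj <-]] // | [v [_]]].
    by rewrite mulVg; apply: in_local1.
  by rewrite finset.sub1set inE => vx; apply: in_local_le.
split=> //; case/orP: bsx => sx; first by apply: Or32; exists x.
by apply: Or33; exists x; split=> //; rewrite finset.sub1set inE.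
Qed.

Lemma bc_vertex_eq_isolated g h (x y : Q) : ~~ (big x || small x) ->
  bc_vertex_eq (g, x) (h, y) <-> x = y /\ g = h.
Proof.
rewrite negb_or => /andP[bx sx].
rewrite /bc_vertex_eq /bc_eq /=; split=> [[/set1_inj <- gh] | [<- <-]].
  split=> //; case: gh => [// | [w [bw /set1_inj xw _]] | [v [sv + _]]].
    by rewrite xw bw in bx.
  rewrite finset.sub1set inE Order.POrderTheory.le_eqVlt => /predU1P[vx | vx].
    by rewrite -vx sv in sx.
  by case/negP: bx; apply/existsP; exists v.
by split=> //; apply: Or31.
Qed.

Definition bc_vertex_rel : rel (G * Q) := fun a b => `[< bc_vertex_eq a b >].

Lemma bc_vertex_refl : reflexive bc_vertex_rel.
Proof. by move=> a; apply/asboolP; split=> //; apply: Or31. Qed.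

Lemma bc_vertex_sym : symmetric bc_vertex_rel.
Proof.
suff h a b : bc_vertex_rel a b -> bc_vertex_rel b a.
  by move=> a b; apply/idP/idP; apply: h.
case: a b => [g x] [h y] /asboolP e; apply/asboolP.
have [bsx | bsx] := boolP (big x || small x).
  have [exy gh] := (bc_vertex_eqE g h y bsx).1 e; subst y.
  by apply/(bc_vertex_eqE _ _ _ bsx); split=> //;
    move/in_localV: gh; rewrite invgM invgK.
have [-> ->] := (bc_vertex_eq_isolated g h y bsx).1 e.
by split=> //; apply: Or31.
Qed.

Lemma bc_vertex_trans : transitive bc_vertex_rel.
Proof.
move=> [h y] [g x] [k z] /asboolP e1 /asboolP e2; apply/asboolP.
have [bsx | bsx] := boolP (big x || small x).
  have [exy gh] := (bc_vertex_eqE g h y bsx).1 e1; subst y.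
  have [exz hk] := (bc_vertex_eqE h k z bsx).1 e2; subst z.
  apply/(bc_vertex_eqE _ _ _ bsx); split=> //.
  by have := in_localM gh hk; rewrite -mulgA mulKVg.
have [exy ->] := (bc_vertex_eq_isolated g h y bsx).1 e1.
by rewrite exy.
Qed.

Canonical bc_vertex_equiv :=
  EquivRel bc_vertex_rel bc_vertex_refl bc_vertex_sym bc_vertex_trans.

Definition bc_vertex := {eq_quot bc_vertex_equiv}.

Definition bc_class (g : G) (x : Q) : bc_vertex := \pi_bc_vertex (g, x).

Lemma bc_classP g h x y :
  bc_class g x = bc_class h y <-> bc_vertex_eq (g, x) (h, y).
Proof. by split=> [/eqmodP/asboolP | e] //; apply/eqmodP/asboolP. Qed.

Lemma bc_class_inj g h x y : bc_class g x = bc_class h y -> x = y.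
Proof. by move=> /bc_classP[/set1_inj]. Qed.

(* Two edges of the quotient with the same end points coincide, so that the
   quotient graph is simple and is described by its adjacency relation. *)
Lemma bc_edge_eq g h (x y : Q) : graphical_poset Q -> (x < y)%O ->
  bc_eq (g, [set x; y]) (h, [set x; y]) <->
  bc_class g x = bc_class h x /\ bc_class g y = bc_class h y.
Proof.
move=> gQ xy.
have sx : small x by apply/existsP; exists y.
have bigy : big y by apply/existsP; exists x.
split=> [[_ /= gh] | [/bc_classP e _]].
  have {}gh : in_local x (g^-1 * h) /\ in_local y (g^-1 * h).
    case: gh => [-> | [w [_ + _]] | [v [_ + gh]]].
    - by rewrite mulVg; split; apply: in_local1.
    - move=> /setP e; have := e x; have := e y.
      rewrite !inE !eqxx orbT /= => /esym/eqP yw /esym/eqP xw.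
      by rewrite xw yw Order.POrderTheory.ltxx in xy.
    - rewrite finset.subUset !finset.sub1set !inE => /andP[vx vy].
      by split; apply: in_local_le gh.
  by split; apply/bc_classP; apply/bc_vertex_eqE; rewrite ?sx ?bigy ?orbT //;
    case: gh.
have [_ gh] := (bc_vertex_eqE g h x (introT orP (or_intror sx))).1 e.
split=> //=; apply: Or33; exists x; split=> //.
rewrite finset.subUset !finset.sub1set !inE.
by rewrite Order.POrderTheory.lexx Order.POrderTheory.ltW.
Qed.

Definition bc_adj (s t : bc_vertex) : Prop :=
  exists (g : G) (x y : Q),
    [/\ linked x y, s = bc_class g x & t = bc_class g y].

Lemma bc_adj_sym s t : bc_adj s t -> bc_adj t s.
Proof.
by move=> [g [x [y [xy -> ->]]]]; exists g, y, x; split=> //; apply: linked_sym.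
Qed.

Lemma bc_adj_irrefl s : ~ bc_adj s s.
Proof.
move=> [g [x [y [xy -> /bc_class_inj exy]]]].
by move: xy; rewrite exy; apply: linked_irrefl.
Qed.

Definition bc_graph : sgraph := SGraph bc_adj_sym bc_adj_irrefl.

Definition bc_map (g : G) : order_graph Q -> bc_graph := bc_class g.

Lemma bc_map_immersion g : immersion (bc_map g).
Proof.
split=> [x y xy | x y z _ _ /bc_class_inj //].
by exists g, x, y.
Qed.

Lemma order_graph_finite : finite_set [set: order_graph Q]%classic.
Proof. exact: (@finite_finset Q). Qed.

Definition basic_construction : graphical_complex :=
  GraphicalComplex (fg_countable G) (fun=> order_graph_finite)
    bc_map_immersion.

End BasicConstruction.

(* Main.v *)
From HB Require Import structures.
Require Import Defs.
From mathcomp Require Import all_boot all_order all_fingroup.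
From mathcomp Require Import zmodp.
From mathcomp Require Import all_classical.
Import Order.POrderTheory.

Set Implicit Arguments.
Unset Strict Implicit.
Unset Printing Implicit Defensive.

(** A path that lifts to the cones of [g] and of [h] has the same lift [q] in
    both, because the map to the base remembers the vertex of the poset; all
    that distinguishes the two factorisations is the element [g^-1 * h], which
    lies in the local group of every vertex of [q], and which is not [1] since
    otherwise the identity would be a compatible isomorphism.  A path with
    three edges has a big vertex [w] in its interior, with neighbours
    [v1 != v2] below [w].  The local groups of [v1] and [v2] meet trivially in
    that of [w], so, as soon as the local groups inject into the fundamental
    group, a piece has at most two edges.  A cycle factoring through a cone has
    at least [2k] edges, hence is not the concatenation of fewer than [k]
    pieces.

    The substance is therefore developability ([fg_in_inj]): the local groups
    inject into the colimit.  By the universal property it is enough to find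
    compatible free actions of all the local groups on one set.  These are
    built in the manner of an unfolding, by partial actions: on a set of
    points, each local group acts freely on a part of it, compatibly with the
    inclusions.  A point [x] has a set [S x] of vertices whose group is defined
    at [x]; it is the part of the link of a chamber that has already been
    built, and it is a down-set.  A partial action can be enlarged
    ([extension]) by embedding parts of it equivariantly into new free orbits
    of the local groups.  One round of three such enlargements ([completion])
    makes every local group defined at all the points present so far; the
    points created on the way have an [S x] which is a ball of radius at most
    three about some vertex, possibly with some branches missing
    ([star_shaped]).  The union of an infinite sequence of rounds is the wanted
    action.

    The girth of the realisation, at least twelve, is what makes a round
    consistent, through two properties of [S] ([admissible]).  If [w] is
    outside [S x], at most one [v < w] is in [S x]: so the part of the set
    joined to [x] by the groups below [w] is either [x] or one orbit of the
    group of [v], and it embeds in the group of [w].  If [v] is outside [S x],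
    at most one [w > v] has a smaller vertex in [S x]: the others put no further
    constraint on the new orbit of [x] under the group of [v].  Triangles can
    occur in the group of [w], namely [a * b = c] with [a], [b], [c] in three
    different smaller groups, so a point created in the orbit of [w] may be
    reached from several old points; the second property confines these
    coincidences to a single orbit.  Both properties hold for star-shaped sets
    because reduced paths of total length less than twelve with the same ends
    coincide. *)

(** * Short paths in a huge poset *)

Section Girth.
Variables (d : Order.disp_t) (Q : finPOrderType d).
Hypothesis gQ : graphical_poset Q.
Implicit Types (x y z u v w c : Q) (p q s : seq Q).

Lemma no_long_chain x y z : (x < y)%O -> (y < z)%O -> False.
Proof.
move=> xy yz; have xz := lt_trans xy yz.
have ch : chain [set x; y; z]%SET.
  apply/'forall_implyP => a; rewrite !inE => /orP[/orP[]|] /eqP->;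
  apply/'forall_implyP => b; rewrite !inE => /orP[/orP[]|] /eqP->;
  by rewrite /Order.comparable ?lexx ?(ltW xy) ?(ltW yz) ?(ltW xz) ?orbT.
have := gp_dim1 gQ ch; rewrite -finset.setUA cardsU1 cards2 !inE.
by rewrite (lt_eqF xy) (lt_eqF xz) (lt_eqF yz).
Qed.

Lemma linked_lt v w : (v < w)%O -> linked v w.
Proof. by rewrite /linked => ->. Qed.

Lemma linked_gt v w : (v < w)%O -> linked w v.
Proof. by move/linked_lt/linked_sym. Qed.

Lemma linked_small x y : linked x y -> small x -> ~~ small y.
Proof.
move=> /orP[xy | yx] /existsP[z xz]; apply/existsP => -[t yt].
  exact: no_long_chain xy yt.
exact: no_long_chain yx xz.
Qed.

Lemma big_or_small u : big u \/ small u.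
Proof.
have /card_gt1P[x [y [_ _ xy]]] := gp_nontrivial gQ.
have [z zu] : exists z, z != u.
  by have [xu|] := eqVneq x u; [exists y; rewrite -xu eq_sym | exists x].
have /connectP[[|t p] /=] := gp_connected gQ u z.
  by move=> _ e; rewrite e eqxx in zu.
move=> /andP[/orP[ut|tu] _] _; [right | left]; apply/existsP; by exists t.
Qed.

(** The realisation is bipartite: along a cycle the successor of a small vertex
    is not small. *)
Lemma card_small_cycle n (c : cycle_graph n -> order_graph Q) :
  embedded_cycle c ->
  (#|[set c i | i : 'I_n.+3 & small (c i)]%SET|).*2 <= n.+3.
Proof.
move=> [homc injc]; set I := [set i : 'I_n.+3 | small (c i)]%SET.
have -> : [set c i | i : 'I_n.+3 & small (c i)]%SET = [set c i | i in I]%SET.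
  by apply: eq_imset => i //; rewrite inE.
rewrite card_imset // -addnn -{2}(card_imset I (@ordS_inj n.+3)).
have dis : [disjoint I & [set ordS i | i in I]%SET].
  rewrite disjoint_sym; apply/pred0P => j /=; apply/negP => /andP[].
  move=> /imsetP[i]; rewrite inE => si -> {j}; rewrite inE; apply/negP.
  apply: linked_small si; apply: homc; left; exact: val_inj.
move: dis; rewrite -leq_card_setU => /eqP <-.
by rewrite -[X in _ <= X]card_ord max_card.
Qed.

Variable k : nat.
Hypothesis hQ : huge Q k.

Lemma cycle_size s : path.cycle (@linked d Q) s -> uniq s -> 2 < size s ->
  k.*2 <= size s.
Proof.
move=> cs us s2; have [x0 _] : exists x0 : Q, x0 \in s.
  by case: s s2 {cs us} => // x s; exists x; rewrite mem_head.
have [n sn] : exists n, size s = n.+3 by exists (size s - 3);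
    rewrite -addn3 subnK.
pose c (i : cycle_graph n) : order_graph Q := nth x0 s i.
have lt_s (i : 'I_n.+3) : i < size s by rewrite sn.
have step (i : 'I_n.+3) : linked (c i) (c (ordS i)).
  have := next_cycle cs (mem_nth x0 (lt_s i)).
  rewrite next_nth mem_nth // index_uniq //.
  rewrite /c; case: (s) sn => // y s' /= [sn].
  have := ltn_ord i; rewrite ltnS leq_eqVlt => /predU1P[-> | i_lt].
    by rewrite modnn [nth y _ _]nth_default ?sn.
  by rewrite modn_small //= (set_nth_default x0) // sn.
have ec : embedded_cycle c.
  split=> [i j|i j].
    have e (l : 'I_n.+3) : inZp l.+1 = ordS l by exact: val_inj.
    case=> <-; rewrite e; first exact: step.
    by apply: linked_sym; apply: step.
  by move=> /eqP; rewrite nth_uniq // => /eqP/val_inj.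
rewrite sn; apply: leq_trans (card_small_cycle ec).
by rewrite leq_double; apply: hQ.
Qed.

(** Absence of backtracking, for a walk given by the list of its vertices. *)
Fixpoint reduced s : bool :=
  if s is x :: t then (if t is _ :: z :: _ then x != z else true) && reduced t
  else true.

(** In a reduced walk, a first return to its starting point would close up an
    embedded cycle, too short if the walk has at most [2k] vertices. *)
Lemma reduced_uniq s : sorted (@linked d Q) s -> reduced s ->
  size s <= k.*2 -> uniq s.
Proof.
elim: s => //= x p IH px /andP[xp rp] sz.
have sp := path_sorted px; have up := IH sp rp (ltnW sz).
rewrite up andbT; apply/negP => xinp.
have ip : index x p < size p by rewrite index_mem.
have sc : size (take (index x p) p) = index x p by rewrite size_takel // ltnW.
have cyc : path.cycle (@linked d Q) (x :: take (index x p) p).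
  move: px; case/path.splitP: xinp => p1 p2.
  by rewrite /= cat_path => /andP[].
have := cycle_size cyc; rewrite /= sc => H.
have : k.*2 <= (index x p).+1.
  apply: H; last first.
    move: px xp; case: (p) xinp => // y [|z t]; rewrite /= !inE.
      by move=> /eqP <-; rewrite (negbTE (introN idP (@linked_irrefl _ _ x))).
    move=> _ /andP[xy _] xz; rewrite [z == x]eq_sym (negbTE xz).
    by case: eqP xy => // -> /linked_irrefl.
  by rewrite take_uniq // andbT in_take // ltnn.
by rewrite leqNgt (leq_ltn_trans ip sz).
Qed.

Lemma reduced_catrev x p q : reduced (x :: p) -> reduced (x :: q) ->
  (forall y p' z q', p = y :: p' -> q = z :: q' -> y != z) ->
  reduced (catrev p (x :: q)).
Proof.
elim: p x q => //= y p IH x q /andP[xp rp] rq dif.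
apply: IH => //.
  by case: q rq dif => //= z q -> dif; rewrite andbT; apply: dif.
by move=> y' p' z q' ep [<- _]; move: xp; rewrite ep eq_sym.
Qed.

Lemma sorted_catrev x p q :
  path (@linked d Q) x p -> path (@linked d Q) x q ->
  sorted (@linked d Q) (catrev p (x :: q)).
Proof.
elim: p x q => //= y p IH x q /andP[xy py] pq.
by apply: IH => //=; rewrite pq linked_sym.
Qed.

(** Where the two paths first part, the reverse of one followed by the other is
    a reduced walk, which has to be injective. *)
Lemma reduced_path_unique x p q :
  path (@linked d Q) x p -> path (@linked d Q) x q ->
  reduced (x :: p) -> reduced (x :: q) ->
  last x p = last x q -> size p + size q < k.*2 -> p = q.
Proof.
elim: p x q => [|y p IH] x [|z q] //.
- move=> _ pq _ rq /= e sz; have := @reduced_uniq (_ :: _ :: _) pq rq sz.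
  by rewrite /= e mem_last.
- move=> pq _ rq _ /= e sz; rewrite addn0 in sz.
  by have := @reduced_uniq (_ :: _ :: _) pq rq sz; rewrite /= -e mem_last.
have [<- /=|yz] := eqVneq y z.
  move=> /andP[_ pp] /andP[_ pq] /andP[_ rp] /andP[_ rq] e sz.
  by rewrite (IH _ _ pp pq rp rq e) // (leq_ltn_trans _ sz) // leq_add.
move=> pp pq rp rq e sz.
have : uniq (catrev (y :: p) (x :: z :: q)).
  apply: reduced_uniq; first exact: sorted_catrev.
    by apply: reduced_catrev => // ? ? ? ? [<- _] [<- _].
  by rewrite catrevE size_cat size_rev /= addnS.
rewrite catrevE cat_uniq => /and3P[_ /hasPn H _].
have := H (last x (z :: q)); rewrite -{2}e mem_rev /= mem_last.
by rewrite inE mem_last orbT => /(_ isT).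
Qed.

Lemma reduced_rcons s w : reduced s -> w \notin s -> reduced (rcons s w).
Proof.
elim: s => //= x s IH /andP[xs rs]; rewrite inE negb_or => /andP[wx ws].
rewrite IH // andbT; case: s {IH rs ws} xs => //= y [|z s] //= _.
by rewrite eq_sym.
Qed.

Hypothesis k6 : 6 <= k.

Let k12 : 12 <= k.*2. Proof. by rewrite -[12]/(6.*2) leq_double. Qed.

Lemma common_lower_unique u u' v v' : u != u' ->
  (v < u)%O -> (v < u')%O -> (v' < u)%O -> (v' < u')%O -> v = v'.
Proof.
move=> uu vu vu' v'u v'u'.
have : [:: v; u'] = [:: v'; u'].
  apply: (@reduced_path_unique u); rewrite /= ?uu //.
  - by rewrite linked_gt // linked_lt.
  - by rewrite linked_gt // linked_lt.
  - exact: leq_trans k12.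
by case.
Qed.

Lemma hexagon u u' v v' x c : v != x -> v' != x -> u != c -> u' != c ->
  (x < u)%O -> (x < u')%O -> (v < u)%O -> (v' < u')%O -> (v < c)%O ->
    (v' < c)%O ->
  u = u'.
Proof.
move=> vx v'x uc u'c xu xu' vu v'u' vc v'c.
have : [:: u; v; c] = [:: u'; v'; c].
  apply: (@reduced_path_unique x);
    rewrite /= ?[x == _]eq_sym ?vx ?v'x ?uc ?u'c //.
  - by rewrite (linked_lt xu) (linked_gt vu) linked_lt.
  - by rewrite (linked_lt xu') (linked_gt v'u') linked_lt.
  - exact: leq_trans k12.
by case.
Qed.

(** The vertices below [c], and those below some [w] at distance at most two
    from [c]; the element [v] of the first condition is the midpoint of a path
    from [c] to [w] of length two, or [c] itself when [c] is small. *)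
Definition star_shaped (S : Q -> Prop) : Prop :=
  exists (c : Q) (W : Q -> Prop),
    (forall w, W w -> exists v, (v <= c)%O /\ (v < w)%O) /\
    forall u, S u <-> (u <= c)%O \/ exists w, W w /\ (u <= w)%O.

(** The two conditions on the set [S] of local groups already defined at a point
    that make the next round consistent. The vertices [v1] and [v2] of the
    second one witness that [w] and [w'] sit above an orbit which exists
    already. *)
Record admissible (S : Q -> Prop) : Prop := {
  adm_lower : forall w v1 v2, ~ S w -> (v1 < w)%O -> (v2 < w)%O ->
    S v1 -> S v2 -> v1 = v2;
  adm_upper : forall v w w' v1 v2, ~ S v -> (v < w)%O -> (v < w')%O ->
    (v1 < w)%O -> (v2 < w')%O -> S v1 -> S v2 -> w = w'
}.

Lemma star_shaped_path S : star_shaped S -> exists c, forall u, S u ->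
  exists p, [/\ path (@linked d Q) c p, reduced (c :: p), last c p = u,
                size p <= 3 & forall y, y \in c :: p -> S y].
Proof.
move=> [c [W [Wc SE]]]; exists c => u Su.
have near t : (t <= c)%O -> exists p, [/\ path (@linked d Q) c p,
    reduced (c :: p), last c p = t, size p <= 3 & forall y,
      y \in c :: p -> S y].
  move=> tc; move: (tc); rewrite le_eqVlt => /predU1P[-> | lt_tc].
    exists [::]; split=> // y; rewrite inE => /eqP->.
    by apply/SE; left.
  exists [:: t]; split=> //=; first by rewrite linked_gt.
  by move=> y; rewrite !inE => /orP[]/eqP->; apply/SE; left.
have [//|[w [Ww uw]]] := (SE u).1 Su; first exact: near.
have [wc|wc] := boolP (w <= c)%O; first by apply: near; apply: le_trans wc.
have [v [vc vw]] := Wc w Ww.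
have [uc|uc] := boolP (u <= c)%O; first exact: near.
have wnc : w != c by apply: contraNneq wc => ->.
have unc : u != c by apply: contraNneq uc => ->.
have unv : u != v by apply: contraNneq uc => ->.
have Sc : S c by apply/SE; left.
have Sv : S v by apply/SE; left.
have Sw : S w by apply/SE; right; exists w.
move: vc uw; rewrite !le_eqVlt => /predU1P[evc | lt_vc] /predU1P[euw | lt_uw].
- exists [:: w]; split=> //=; first by rewrite -evc linked_lt.
  by move=> y; rewrite !inE => /orP[]/eqP->.
- exists [:: w; u]; split=> //=.
  + by rewrite -evc linked_lt // linked_gt.
  + by rewrite eq_sym unc.
  + by move=> y; rewrite !inE => /or3P[]/eqP->.
- exists [:: v; w]; split=> //=.
  + by rewrite linked_gt // linked_lt.
  + by rewrite eq_sym wnc.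
  + by move=> y; rewrite !inE => /or3P[]/eqP->.
- exists [:: v; w; u]; split=> //=.
  + by rewrite linked_gt // linked_lt //= linked_gt.
  + by rewrite eq_sym wnc eq_sym unv.
  + by move=> y; rewrite !inE => /or4P[]/eqP->.
Qed.

(** Two reduced paths from the centre inside [S] remain reduced when prolonged
    by one or two vertices outside [S]. If they end at the same vertex, their
    total length is at most [4 + 4], respectively [5 + 5], and they coincide. *)
Lemma star_shaped_admissible S : star_shaped S -> admissible S.
Proof.
move=> starS; have [c cP] := star_shaped_path starS.
have down u v : (v <= u)%O -> S u -> S v.
  case: starS => c' [W [_ SE]] vu /SE[uc|[w [Ww uw]]]; apply/SE.
    by left; apply: le_trans uc.
  by right; exists w; split=> //; apply: le_trans uw.
have out (s : seq Q) w : (forall y, y \in s -> S y) -> ~ S w -> w \notin s.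
  by move=> sS nSw; apply/negP => /sS.
split=> [w v1 v2 nSw v1w v2w Sv1 Sv2 | v w w' v1 v2 nSv vw vw' v1w v2w' Sv1
  Sv2].
  have [p [pp rp lp sp Sp]] := cP _ Sv1; have [q [pq rq lq sq Sq]] := cP _ Sv2.
  have : rcons p w = rcons q w.
    apply: (@reduced_path_unique c).
    + by rewrite rcons_path pp lp linked_lt.
    + by rewrite rcons_path pq lq linked_lt.
    + by rewrite -rcons_cons; apply: reduced_rcons => //; apply: out.
    + by rewrite -rcons_cons; apply: reduced_rcons => //; apply: out.
    + by rewrite !last_rcons.
    + by rewrite !size_rcons addSn addnS; apply: leq_trans k12;
        rewrite !ltnS; apply: leq_trans (leq_add sp sq) _.
  by move=> /rcons_inj[epq]; rewrite -lp -lq epq.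
have nSw : ~ S w by apply: contra_not nSv; apply: down; apply: ltW.
have nSw' : ~ S w' by apply: contra_not nSv; apply: down; apply: ltW.
have [p [pp rp lp sp Sp]] := cP _ Sv1; have [q [pq rq lq sq Sq]] := cP _ Sv2.
have : rcons (rcons p w) v = rcons (rcons q w') v.
  apply: (@reduced_path_unique c).
  + by rewrite !rcons_path pp lp last_rcons linked_lt // linked_gt.
  + by rewrite !rcons_path pq lq last_rcons linked_lt // linked_gt.
  + rewrite -!rcons_cons; apply: reduced_rcons.
      by apply: reduced_rcons => //; apply: out.
    by rewrite mem_rcons inE negb_or (lt_eqF vw) /=; apply: out.
  + rewrite -!rcons_cons; apply: reduced_rcons.
      by apply: reduced_rcons => //; apply: out.
    by rewrite mem_rcons inE negb_or (lt_eqF vw') /=; apply: out.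
  + by rewrite !last_rcons.
  + by rewrite !size_rcons !addSn !addnS; apply: leq_trans k12;
      rewrite !ltnS; apply: leq_trans (leq_add sp sq) _.
by move=> /rcons_inj[/rcons_inj[]].
Qed.

End Girth.

(** * Local maps *)

Section LocalMaps.
Local Open Scope group_scope.
Variables (d : Order.disp_t) (Q : finPOrderType d) (A : complex_of_groups Q).
Implicit Types u v w : Q.

(** The map between local groups along [u <= w], extended by [1] to all pairs so
    that equal and strictly comparable vertices are treated alike. *)
Definition local_map u w (a : A u) : A w :=
  match u =P w with
  | ReflectT e => eq_rect u (fun v => A v : Type) a w e
  | ReflectF _ =>
    match @idP (u < w)%O with
    | ReflectT uw => cg_map A uw a
    | ReflectF _ => 1
    end
  end.

Lemma local_map_id u (a : A u) : local_map u a = a.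
Proof. by rewrite /local_map; case: eqP => // e; rewrite (eq_axiomK e). Qed.

Lemma local_map_lt u w (uw : (u < w)%O) (a : A u) :
  local_map w a = cg_map A uw a.
Proof.
rewrite /local_map; case: eqP => [e | _].
  by exfalso; move: uw; rewrite e ltxx.
by case: {-}_ / idP => // uw'; rewrite (bool_irrelevance uw' uw).
Qed.

Lemma local_mapM u w (a b : A u) : (u <= w)%O ->
  local_map w (a * b) = local_map w a * local_map w b.
Proof.
rewrite le_eqVlt => /predU1P[e | uw].
  by subst w; rewrite !local_map_id.
by rewrite !(local_map_lt uw) gmulfM.
Qed.

Lemma local_map_inj u w : (u <= w)%O -> injective (@local_map u w).
Proof.
rewrite le_eqVlt => /predU1P[e | uw] a b.
  by subst w; rewrite !local_map_id.
by rewrite !(local_map_lt uw) => /cg_inj.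
Qed.

Lemma local_map1 u w : (u <= w)%O -> local_map w (1 : A u) = 1.
Proof.
by move=> uw; apply: (mulgI (local_map w (1 : A u)));
    rewrite -local_mapM // !mulg1.
Qed.

Lemma local_map_disjoint v1 v2 w (a : A v1) (b : A v2) :
  (v1 < w)%O -> (v2 < w)%O -> v1 != v2 -> local_map w a = local_map w b ->
  a = 1 /\ b = 1.
Proof.
move=> v1w v2w v12 e.
have e1 : local_map w a = 1.
  apply/set1P; rewrite -(cg_disjoint A v1w v2w v12) inE.
  by rewrite {1}(local_map_lt v1w) e (local_map_lt v2w) !imset_f.
by split; apply: (@local_map_inj _ w); rewrite ?local_map1 -?e // ltW.
Qed.

Hypothesis gQ : graphical_poset Q.

Lemma local_map_comp u v w (a : A u) : (u <= v)%O -> (v <= w)%O ->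
  local_map w (local_map v a) = local_map w a.
Proof.
rewrite !le_eqVlt => /predU1P[e | uv] /predU1P[e' | vw].
- by subst w; rewrite local_map_id.
- by subst v; rewrite local_map_id.
- by subst w; rewrite local_map_id.
- by have := no_long_chain gQ uv vw.
Qed.

End LocalMaps.
Arguments local_map {d Q A u} w a.

(** * Free partial actions and their extensions *)

(** The first component is the time of birth of a point; it ensures an endless
    supply of new points. *)
Local Notation point := (nat * nat)%type.

Section PartialActions.
Local Open Scope group_scope.
Variables (d : Order.disp_t) (Q : finPOrderType d) (A : complex_of_groups Q).
Implicit Types (u v w : Q) (x y z r : point).

(** [F u a x y] reads: the element [a] of the local group of [u] moves [x] to
    [y]. With relations, an increasing union of partial actions is again one. *)
Definition partial_action := forall u, A u -> point -> point -> Prop.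

Definition defined_at (F : partial_action) x u : Prop := F u 1 x x.

Record free_partial_action (F : partial_action) : Prop := {
  pa_fun : forall u a x y y', F u a x y -> F u a x y' -> y = y';
  pa_comp : forall u a b x y z, F u a x y -> F u b y z -> F u (b * a) x z;
  pa_inv : forall u a x y, F u a x y -> F u a^-1 y x;
  pa_total : forall u x a, defined_at F x u -> exists y, F u a x y;
  pa_free : forall u a x, F u a x x -> a = 1;
  pa_compat : forall u w a x y, (u <= w)%O -> F w (local_map w a) x y ->
    F u a x y
}.

Section Basic.
Variable F : partial_action.
Hypothesis FP : free_partial_action F.

Lemma pa_defl u (a : A u) x y : F a x y -> defined_at F x u.
Proof.
by move=> Fxy; have := pa_comp FP Fxy (pa_inv FP Fxy); rewrite mulVg.
Qed.

Lemma pa_defr u (a : A u) x y : F a x y -> defined_at F y u.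
Proof. by move/(pa_inv FP)/pa_defl. Qed.

Lemma pa_free2 u (a b : A u) x y : F a x y -> F b x y -> a = b.
Proof.
move=> Fa Fb; have := pa_free FP (pa_comp FP Fa (pa_inv FP Fb)).
by move/(canRL (mulKVg _)); rewrite mulg1.
Qed.

Lemma pa_def_transport u w (a : A u) x y : (u <= w)%O -> F a x y ->
  defined_at F x w -> F (local_map w a) x y.
Proof.
move=> uw Fxy /(pa_total FP (local_map w a))[y' Fxy'].
by rewrite (pa_fun FP Fxy (pa_compat FP uw Fxy')).
Qed.

Lemma pa_def_move u w (a : A u) x y : (u <= w)%O -> F a x y ->
  defined_at F x w <-> defined_at F y w.
Proof.
move=> uw Fxy; split=> D.
  exact: pa_defr (pa_def_transport uw Fxy D).
exact: pa_defr (pa_def_transport uw (pa_inv FP Fxy) D).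
Qed.

End Basic.

Definition extends (F F' : partial_action) : Prop :=
  forall u a x y, F u a x y -> F' u a x y.

Definition supported (F : partial_action) (l : nat) : Prop :=
  forall u a x y, F u a x y -> x.1 < l.

Section Extension.
Hypothesis gQ : graphical_poset Q.
Variables (F : partial_action) (l : nat).
Hypothesis FP : free_partial_action F.
Hypothesis Fl : supported F l.
Variable chart : forall u, point -> point -> A u -> Prop.

(** For each [u] there is a set of orbits, named by points [r], on which the
    local group of [u] acts freely; in these, [(r, b)] is the point with
    coordinate [b]. The relation [chart x r b] says that the old point [x] is to
    be identified with [(r, b)]. The first three conditions make this an
    injection compatible with the action of the smaller groups. Condition
    [chart_glue] excludes that the group of [v] becomes defined at [x] for two
    reasons at a time. *)
Record orbit_charts : Prop := {
  chart_fun : forall u x r r' b b', chart x r b -> chart x r' b' ->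
    r = r' /\ b = b' :> A u;
  chart_inj : forall u x y r (b : A u), chart x r b -> chart y r b -> x = y;
  chart_equiv : forall v w x y r (a : A v) (b : A w), (v < w)%O ->
    chart x r b -> F a x y -> chart y r (local_map w a * b);
  chart_new : forall u x r (b : A u), chart x r b -> ~ defined_at F x u;
  chart_glue : forall u u' v x r r' (b : A u) (b' : A u'),
    chart x r b -> chart x r' b' -> (v <= u)%O -> (v <= u')%O ->
    u = u' \/ defined_at F x v;
  chart_old : forall u x r (b : A u), chart x r b -> x.1 < l
}.

Hypothesis CP : orbit_charts.

(** The second component of the new point [(r, b)] of an orbit of [u]. *)
Definition code u r (b : A u) : nat :=
  pickle (Tagged (fun v => (point * A v)%type) (r, b)).

(** Either [x] is the old point identified with [(r, b)], or there is no such
    point and [x] is new; new points are added only to orbits that some old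
    point meets. *)
Definition orbit_point u r (b : A u) x : Prop :=
  chart x r b \/
  [/\ ~ exists y, chart y r b, exists y (b' : A u), chart y r b'
    & x = (l, code r b)].

Definition extension : partial_action := fun u a x y =>
  F a x y \/ exists w r (b : A w),
    [/\ (u <= w)%O, orbit_point r b x & orbit_point r (local_map w a * b) y].

Lemma code_inj u u' r r' (b : A u) (b' : A u') : code r b = code r' b' ->
  exists e : u = u', r = r' /\ eq_rect u (fun v => A v : Type) b u' e = b'.
Proof.
move=> /(pcan_inj pickleK) E; have e := congr1 tag E; rewrite /= in e.
subst u'; exists erefl; have [-> ->] := eq_from_Tagged E; by [].
Qed.

Lemma orbit_point_fun u r (b : A u) x y :
  orbit_point r b x -> orbit_point r b y -> x = y.
Proof.
move=> [cx | [n1 _ ->]] [cy | [n2 _ ->]] //.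
- exact: chart_inj CP _ _ _ _ _ cx cy.
- by case: n2; exists x.
- by case: n1; exists y.
Qed.

(** New points carry their orbit in their code, so that two different new orbits
    meet only in old points. *)
Lemma orbit_point_same u u' r r' (b : A u) (b' : A u') x :
  orbit_point r b x -> orbit_point r' b' x ->
  (exists e : u = u', r = r' /\ eq_rect u (fun v => A v : Type) b u' e = b') \/
  chart x r b /\ chart x r' b'.
Proof.
move=> [cx | [n1 _ ex]] [cx' | [n2 _ ex']]; first by right.
- by have := chart_old CP cx; rewrite ex' ltnn.
- by have := chart_old CP cx'; rewrite ex ltnn.
- by left; apply: code_inj; move: ex; rewrite ex' => -[].
Qed.

Lemma orbit_point_coord u r r' (b b' : A u) x :
  orbit_point r b x -> orbit_point r' b' x -> r = r' /\ b = b'.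
Proof.
move=> o o'; case: (orbit_point_same o o') => [[e [-> <-]] | [c c']].
  by rewrite (eq_axiomK e).
exact: chart_fun CP _ _ _ _ _ _ c c'.
Qed.

Lemma orbit_point_total u r (b b' : A u) x :
  orbit_point r b x -> exists y, orbit_point r b' y.
Proof.
move=> o; have [[y cy] | n] := pselect (exists y, chart y r b').
  by exists y; left.
exists (l, code r b'); right; split=> //.
by case: o => [c | [_ ]] //; exists x, b.
Qed.

Lemma orbit_point_undefined u r (b : A u) x :
  orbit_point r b x -> ~ defined_at F x u.
Proof.
move=> [c | [_ _ ->] /Fl]; first exact: chart_new CP _ _ _ _ c.
by rewrite ltnn.
Qed.

Lemma orbit_point_le u w r (a : A u) (b : A w) x y : (u <= w)%O ->
  orbit_point r b x -> F a x y -> orbit_point r (local_map w a * b) y.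
Proof.
rewrite le_eqVlt => /predU1P[e | uw] o Fxy.
  by subst w; case: (orbit_point_undefined o); apply: pa_defl Fxy.
case: o => [c | [_ _ ex]]; first by left;
  apply: chart_equiv CP _ _ _ _ _ _ _ uw c Fxy.
by have := Fl Fxy; rewrite ex ltnn.
Qed.

Lemma orbit_point_glue u w w' r r' (b : A w) (b' : A w') x :
  (u <= w)%O -> (u <= w')%O -> orbit_point r b x -> orbit_point r' b' x ->
  defined_at F x u \/
  exists e : w = w', r = r' /\ eq_rect w (fun v => A v : Type) b w' e = b'.
Proof.
move=> uw uw' o o'; case: (orbit_point_same o o') => [e | [c c']];
  first by right.
case: (chart_glue CP c c' uw uw') => [e | ?]; last by left.
by subst w'; right; exists erefl; apply: chart_fun CP _ _ _ _ _ _ c c'.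
Qed.

(** Where the group of [u] acted already, the new orbits induce the same action:
    the charts are equivariant, and the set of charted points is closed under
    the smaller groups. *)
Lemma extension_restrict u (a : A u) x y :
  extension a x y -> defined_at F x u \/ defined_at F y u -> F a x y.
Proof.
move=> [// | [w [r [b [uw ox oy]]]]] [Dx | Dy].
  have [y' Fxy'] := pa_total FP a Dx.
  by rewrite (orbit_point_fun oy (orbit_point_le uw ox Fxy')).
have [x' Fyx'] := pa_total FP a^-1 Dy.
have := orbit_point_le uw oy Fyx'.
rewrite mulgA -local_mapM // mulVg local_map1 // mul1g =>
  /(orbit_point_fun ox) ->.
by have := pa_inv FP Fyx'; rewrite invgK.
Qed.

(** Every law is checked separately where [F] was defined, and where it was not:
    there [chart_glue] shows that all the moves involved happen in one new
    orbit. *)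
Lemma extension_ok : free_partial_action extension.
Proof.
have inv u (a : A u) x y : extension a x y -> extension a^-1 y x.
  move=> [/(pa_inv FP) | [w [r [b [uw ox oy]]]]]; first by left.
  right; exists w, r, (local_map w a * b); split=> //.
  by rewrite mulgA -local_mapM // mulVg local_map1 // mul1g.
have new u (a : A u) x y : ~ defined_at F x u -> extension a x y ->
    exists w r (b : A w),
    [/\ (u <= w)%O, orbit_point r b x & orbit_point r (local_map w a * b) y].
  by move=> nD [/(pa_defl FP) | ].
split=> //.
- move=> u a x y y' Exy Exy'; have [Dx | nD] := pselect (defined_at F x u).
    apply: (pa_fun FP) (extension_restrict Exy _) (extension_restrict Exy' _);
    by left.
  have [w [r [b [uw ox oy]]]] := new _ _ _ _ nD Exy.
  have [w' [r' [b' [uw' ox' oy']]]] := new _ _ _ _ nD Exy'.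
  have [//|[e [er eb]]] := orbit_point_glue uw uw' ox ox'.
  by subst w' r'; rewrite -eb in oy'; apply: orbit_point_fun oy oy'.
- move=> u a b x y z Exy Eyz; have [Dy | nD] := pselect (defined_at F y u).
    left; apply: (pa_comp FP) (extension_restrict Exy _) (extension_restrict
      Eyz _);
    by [right | left].
  have nDx : ~ defined_at F x u.
    move=> Dx; have := extension_restrict Exy (or_introl Dx).
    by move/(pa_defr FP).
  have [w [r [c [uw ox oy]]]] := new _ _ _ _ nDx Exy.
  have [w' [r' [c' [uw' oy' oz]]]] := new _ _ _ _ nD Eyz.
  have [//|[e [er ec]]] := orbit_point_glue uw uw' oy oy'.
  subst w' r'; rewrite -ec /= in oz; right; exists w, r, c; split=> //.
  by rewrite local_mapM // -mulgA.
- move=> u x a [D | [w [r [b [uw ox _]]]]].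
    by have [y ?] := pa_total FP a D; exists y; left.
  have [y oy] := orbit_point_total (local_map w a * b) ox.
  by exists y; right; exists w, r, b.
- move=> u a x Exx; have [D | nD] := pselect (defined_at F x u).
    by apply: (pa_free FP) (extension_restrict Exx _); left.
  have [w [r [b [uw ox ox']]]] := new _ _ _ _ nD Exx.
  have [_ /(canLR (mulgK _))] := orbit_point_coord ox ox'.
  by rewrite mulgV -(local_map1 A uw) => /(local_map_inj uw).
- move=> u v a x y uv [Fxy | [w [r [b [vw ox oy]]]]].
    by left; apply: pa_compat Fxy.
  right; exists w, r, b; split=> //; first exact: le_trans vw.
  by rewrite -(local_map_comp gQ a uv vw).
Qed.

Lemma extension_extends : extends F extension.
Proof. by move=> u a x y; left. Qed.

Lemma orbit_point_supported u r (b : A u) x : orbit_point r b x -> x.1 <= l.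
Proof. by move=> [/(chart_old CP)/ltnW | [_ _ ->]] /=. Qed.

Lemma extension_supported : supported extension l.+1.
Proof.
move=> u a x y [/Fl/ltnW // | [w [r [b [_ /orbit_point_supported]]]]] //.
Qed.

Lemma extension_old u x : x.1 < l -> defined_at extension x u <->
  defined_at F x u \/ exists w r (b : A w), (u <= w)%O /\ chart x r b.
Proof.
move=> xl; split=> [[D | [w [r [b [uw [c | [_ _ ex]] _]]]]]
  | [D | [w [r [b [uw c]]]]]].
- by left.
- by right; exists w, r, b.
- by rewrite ex ltnn in xl.
- by left.
- by right; exists w, r, b; rewrite local_map1 // mul1g; split=> //; left.
Qed.

(** The point belongs to at most one new orbit, and then it sees the vertices
    below the vertex of this orbit, and no others. *)
Lemma extension_fresh x : x.1 = l ->
  (forall u, ~ defined_at extension x u) \/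
  exists c, forall u, defined_at extension x u <-> (u <= c)%O.
Proof.
move=> xl.
have notF u : ~ defined_at F x u by move=> /Fl; rewrite xl ltnn.
have nochart u r (b : A u) : ~ chart x r b.
  by move=> /(chart_old CP); rewrite xl ltnn.
have [[c [r [b o]]] | n] := pselect (exists c r (b : A c), orbit_point r b x).
  right; exists c => u; split=> [[/notF // | [w [r' [b' [uw o' _]]]]] | uc].
    case: (orbit_point_same o o') => [[e _] | [/nochart //]].
    by rewrite e.
  by right; exists c, r, b; rewrite local_map1 // mul1g.
left=> u [/notF // | [w [r [b [_ o _]]]]]; apply: n.
by exists w, r, b.
Qed.

Lemma extension_old_pair u (a : A u) x y : x.1 < l -> y.1 < l ->
  extension a x y -> F a x y \/
  exists w r (b : A w), [/\ (u <= w)%O, chart x r b & chart y r (local_map w a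
    * b)].
Proof.
move=> xl yl [Fxy | [w [r [b [uw ox oy]]]]]; first by left.
right; exists w, r, b; split=> //.
  by case: ox => // -[_ _ ex]; rewrite ex ltnn in xl.
by case: oy => // -[_ _ ey]; rewrite ey ltnn in yl.
Qed.

End Extension.

End PartialActions.

(** * One round of completion *)

Section Layer.
Local Open Scope group_scope.
Variables (d : Order.disp_t) (Q : finPOrderType d) (A : complex_of_groups Q).
Hypothesis gQ : graphical_poset Q.
Variable k : nat.
Hypothesis k6 : (6 <= k)%N.
Hypothesis hQ : huge Q k.
Implicit Types (u v w c : Q) (x y z r : point).

(** The points born at time [l] or later are still unused. *)
Record stage (F : partial_action A) (l : nat) : Prop := {
  stage_action : free_partial_action F;
  stage_supported : supported F l;
  stage_admissible : forall x, admissible (defined_at F x)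
}.

Section Completion.
Variables (F : partial_action A) (l : nat).
Hypothesis FS : stage F l.

Let FP := stage_action FS.
Let Fl := stage_supported FS.
Let Fadm := stage_admissible FS.

Definition neighbour w x : set point :=
  [set y | exists v (a : A v), (v < w)%O /\ F a y x]%classic.

(** The first enlargement: [w] is not defined at [x], but some [v < w] is. This
    [v] is unique, the orbit of [x] under its group is all that the groups below
    [w] can reach, and it is embedded in an orbit of [w]. The origin [r] of the
    coordinates is a point chosen in this orbit, depending on the orbit only. *)
Definition attached_chart w x r (b : A w) : Prop :=
  [/\ ~ defined_at F x w,
      exists v (a : A v), [/\ (v < w)%O, F a r x & b = local_map w a]
    & r = xget (0, 0) (neighbour w x)].


Lemma neighbour_step w x y v (a : A v) : (v < w)%O -> ~ defined_at F x w ->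
  F a x y -> neighbour w x = neighbour w y.
Proof.
suff H x' y' (a' : A v) : (v < w)%O -> ~ defined_at F x' w -> F a' x' y' ->
    (neighbour w x' `<=` neighbour w y')%classic.
  move=> vw nD Fxy; apply/seteqP; split; first exact: H vw nD Fxy.
  by apply: (H _ _ a^-1 vw _ (pa_inv FP Fxy));
      rewrite -(pa_def_move FP (ltW vw) Fxy).
move=> vw nD Fxy z [v' [b [v'w Fzx]]].
have e := adm_lower (Fadm x') nD vw v'w (pa_defl FP Fxy) (pa_defr FP Fzx).
by subst v'; exists v, (a' * b); split=> //; apply: (pa_comp FP) Fzx Fxy.
Qed.

(** That the coordinates are well defined, injective and equivariant rests on
    the uniqueness of [v]; [chart_glue] is the second property of admissible
    sets. *)
Lemma attached_chartP : orbit_charts F l attached_chart.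
Proof.
split.
- move=> w x r r' b b' [nD [v [a [vw Fa ->]]] er] [_ [v' [a' [v'w Fa' ->]]]
    er'].
  rewrite er' er; split=> //; rewrite -er in er'; rewrite er' in Fa'.
  have e := adm_lower (Fadm x) nD vw v'w (pa_defr FP Fa) (pa_defr FP Fa').
  by subst v'; rewrite (pa_free2 FP Fa Fa').
- move=> w x y r b [nD [v [a [vw Fa eb]]] _] [_ [v' [a' [v'w Fa' eb']]] _].
  have nDr : ~ defined_at F r w by rewrite (pa_def_move FP (ltW vw) Fa).
  have e := adm_lower (Fadm r) nDr vw v'w (pa_defl FP Fa) (pa_defl FP Fa').
  subst v'; rewrite eb in eb'; move/(local_map_inj (ltW vw)): eb' => e.
  by subst a'; apply: (pa_fun FP) Fa Fa'.
- move=> v w x y r a b vw [nD [v' [a' [v'w Fa' ->]]] er] Fxy.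
  have e := adm_lower (Fadm x) nD vw v'w (pa_defl FP Fxy) (pa_defr FP Fa').
  subst v'; split; first by rewrite -(pa_def_move FP (ltW vw) Fxy).
    exists v, (a * a'); split=> //; first exact: (pa_comp FP) Fa' Fxy.
    by rewrite local_mapM // ltW.
  by rewrite er (neighbour_step vw nD Fxy).
- by move=> u x r b [].
- move=> u u' v x r r' b b' [nD [v1 [a [v1u Fa _]]] _]
    [nD' [v2 [a' [v2u' Fa' _]]] _].
  have [? vu vu' | nDv] := pselect (defined_at F x v); first by right.
  rewrite !le_eqVlt => /predU1P[e | vu] /predU1P[e' | vu'].
  + by left; rewrite -e -e'.
  + by subst v; case: (no_long_chain gQ v1u vu').
  + by subst v; case: (no_long_chain gQ v2u' vu).
  + left; apply: (adm_upper (Fadm x) nDv) vu vu' v1u v2u' _ _.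
      exact: pa_defr Fa.
    exact: pa_defr Fa'.
- by move=> u x r b [_ [v [a [_ /(pa_inv FP)/Fl]]]].
Qed.

Definition attached_ext : partial_action A := extension F l attached_chart.

Let P1 : free_partial_action attached_ext := extension_ok gQ FP Fl
    attached_chartP.
Let S1 : supported attached_ext l.+1 := extension_supported Fl attached_chartP.

Lemma attached_ext_lower w v x : ~ defined_at attached_ext x w -> (v < w)%O ->
  ~ defined_at F x v.
Proof.
move=> nD vw Dx; apply: nD.
have xl : (x.1 < l)%N := Fl Dx.
have [D | nD] := pselect (defined_at F x w).
  exact: extension_extends D.
apply/(extension_old F attached_chart _ xl); right.
have [y [v' [a [v'w Fyx]]]] : exists y, neighbour w x y.
  by exists x, v, 1.
have := @xgetI _ (0, 0) (neighbour w x) y.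
case=> [|v1 [a1 [v1w Fa1]]]; first by exists v', a.
exists w, (xget (0, 0) (neighbour w x)), (local_map w a1); split=> //.
by split=> //; exists v1, a1.
Qed.

(** The second enlargement: each small [v] still missing at an old point [x]
    gets a new orbit, with [x] as its only old point. *)
Definition small_chart v x r (b : A v) : Prop :=
  [/\ (x.1 < l)%N, ~ defined_at attached_ext x v, small v, r = x & b = 1].

Lemma small_chartP : orbit_charts attached_ext l.+1 small_chart.
Proof.
have min v w : (v <= w)%O -> small w -> v = w.
  rewrite le_eqVlt => /predU1P[// | vw] /existsP[t wt].
  by case: (no_long_chain gQ vw wt).
split.
- by move=> v x r r' b b' [_ _ _ -> ->] [_ _ _ -> ->].
- by move=> v x y r b [_ _ _ <- _] [_ _ _ <- _].
- by move=> v w x y r a b vw [_ _ /existsP[t wt]];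
    case: (no_long_chain gQ vw wt).
- by move=> v x r b [].
- move=> u u' v x r r' b b' [_ _ su _ _] [_ _ su' _ _] vu vu'; left.
  by rewrite -(min _ _ vu su) -(min _ _ vu' su').
- by move=> u x r b [/ltnW].
Qed.

Definition small_ext : partial_action A := extension attached_ext l.+1
    small_chart.

Let P2 : free_partial_action small_ext := extension_ok gQ P1 S1 small_chartP.
Let S2 : supported small_ext l.+2 := extension_supported S1 small_chartP.

Lemma small_ext_small x v : (x.1 < l)%N -> small v -> defined_at small_ext x v.
Proof.
move=> xl sv; apply/(extension_old attached_ext small_chart _ (leqW xl)).
have [D | nD] := pselect (defined_at attached_ext x v); [by left | right].
by exists v, x, 1.
Qed.

(** A point born in the first two enlargements lies in at most one orbit, that
    of some [c]. *)
Lemma small_ext_born x : (l <= x.1)%N ->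
  (forall u, ~ defined_at small_ext x u) \/
  exists c, forall u, defined_at small_ext x u <-> (u <= c)%O.
Proof.
rewrite leq_eqVlt => /predU1P[xl | ].
  have E u : defined_at small_ext x u <-> defined_at attached_ext x u.
    rewrite (extension_old attached_ext small_chart _ _) ?xl //.
    by split=> [[// | [w [r [b [_ []]]]]] | ]; [rewrite -xl ltnn | left].
  case: (extension_fresh Fl attached_chartP (esym xl)) => [n | [c H]].
    by left=> u /E/n.
  by right; exists c => u; rewrite E.
rewrite leq_eqVlt => /predU1P[xl | xl].
  case: (extension_fresh S1 small_chartP (esym xl)) => [n | [c H]];
    first by left.
  by right; exists c.
by left=> u /S2; rewrite ltnNge xl.
Qed.

(** When [w] is still missing at [x], no [v < w] was defined at [x] at the
    start, so the orbit of [x] under [v] was made in this round. If it was made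
    by the second enlargement, it contains no other old point. If it was made
    inside an orbit of some [u] by the first one, the old points of that orbit
    are the translates of its origin by the group of some [v1], which meets that
    of [v] trivially. *)
Lemma small_ext_old_pair w v (a : A v) x y : (x.1 < l)%N -> (y.1 < l)%N ->
  ~ defined_at small_ext x w -> (v < w)%O -> small_ext a x y -> a = 1.
Proof.
move=> xl yl nD vw Fxy.
have nD1 : ~ defined_at attached_ext x w.
  by apply: contra_not nD; apply: extension_extends.
have nDv := attached_ext_lower nD1 vw.
case: (extension_old_pair (leqW xl) (leqW yl) Fxy) => [Exy | ]; last first.
  move=> [u [r [b [vu [_ _ su er eb] [_ _ _ er' _]]]]].
  by apply: (pa_free P2 (x := x)); rewrite -{2}er er'.
case: (extension_old_pair xl yl Exy) => [/(pa_defl FP)// | ].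
move=> [u [r [b [vu [nDu [v1 [c [v1u Fc eb]]] _] [_ [v2 [c' [v2u Fc' eb']]]
  _]]]]].
have nDr : ~ defined_at F r u by rewrite (pa_def_move FP (ltW v1u) Fc).
have e := adm_lower (Fadm r) nDr v1u v2u (pa_defl FP Fc) (pa_defl FP Fc').
subst v2 b; have {}vu : (v < u)%O.
  move: vu; rewrite le_eqVlt => /predU1P[e | //].
  by subst u; case: (no_long_chain gQ v1u vw).
have vv1 : v != v1.
  by apply/eqP=> e; subst v1; apply: nDv; apply: pa_defr Fc.
have : local_map u a = local_map u (c' * c^-1).
  by rewrite local_mapM ?ltW // -eb' -mulgA -local_mapM ?ltW // mulgV
      local_map1 ?mulg1 ?ltW.
by case/(local_map_disjoint vu v1u vv1).
Qed.

(** The third enlargement: [w] is still missing at an old point [x], although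
    every [v < w] is defined there. The orbits of [x] under these [v], which
    meet only in [x], are embedded in the orbit of [w] with origin [x]. *)
Definition isolated_chart w z x (b : A w) : Prop :=
  [/\ (x.1 < l)%N, ~ defined_at small_ext x w
    & exists v (a : A v), [/\ (v < w)%O, small_ext a x z & b = local_map w a]].

(** Here [c] is not [w], otherwise [w] would be defined at [z], hence at [x]. *)
Lemma small_ext_new_point w v (a : A v) x z : (x.1 < l)%N ->
    ~ defined_at small_ext x w ->
  (v < w)%O -> small_ext a x z -> z != x ->
  exists c, [/\ (l <= z.1)%N, (v <= c)%O, c != w &
    forall u, defined_at small_ext z u <-> (u <= c)%O].
Proof.
move=> xl nD vw Fxz zx.
have zl : (l <= z.1)%N.
  rewrite leqNgt; apply/negP => zl.
  have a1 := small_ext_old_pair xl zl nD vw Fxz; subst a.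
  by rewrite (pa_fun P2 Fxz (pa_defl P2 Fxz)) eqxx in zx.
have Dz := pa_defr P2 Fxz.
case: (small_ext_born zl) => [/(_ v) // | [c Dc]].
exists c; split=> //; first exact/Dc.
apply/eqP=> e; subst c; apply: nD.
by rewrite (pa_def_move P2 (ltW vw) Fxz) Dc.
Qed.

(** The vertices defined at [z] are those below some [c], and [c] and [w] have
    only one common lower bound. *)
Lemma small_ext_new_lower w v v' (a : A v) x z : (x.1 < l)%N ->
    ~ defined_at small_ext x w ->
  (v < w)%O -> small_ext a x z -> z != x -> (v' < w)%O ->
    defined_at small_ext z v' -> v' = v.
Proof.
move=> xl nD vw Fxz zx v'w Dv'.
have [c [_ vc cw Dc]] := small_ext_new_point xl nD vw Fxz zx.
have v'c := (Dc _).1 Dv'.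
move: vc v'c; rewrite !le_eqVlt => /predU1P[e | vc] /predU1P[e' | v'c].
- by rewrite e e'.
- by subst v; case: (no_long_chain gQ v'c vw).
- by subst v'; case: (no_long_chain gQ vc v'w).
- exact: (common_lower_unique gQ hQ k6 cw).
Qed.

(** A point [z] that is not old determines [v], by the previous lemma, and then
    also [x], the only old point of its orbit under [v]. For [chart_glue], let
    [z] lie in the orbits of [v] and [v'] used for two different [u] and [u'],
    let [c] be the vertex of the orbit in which [z] was born, and let [t] be
    below [u] and [u']: then [t], [u], [v], [c], [v'], [u'] would be a hexagon,
    unless [t] is one of [v] and [v'], which are defined at [z]. *)
Lemma isolated_chartP : orbit_charts small_ext l.+2 isolated_chart.
Proof.
have one w v (a : A v) x : small_ext a x x ->
    local_map w a = local_map w (1 : A v).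
  by move/(pa_free P2) ->.
split.
- move=> w z x x' b b' [xl nD [v [a [vw Fxz ->]]]]
    [x'l nD' [v' [a' [v'w Fx'z ->]]]].
  have [e | zx] := eqVneq z x.
    subst x; have a'1 := small_ext_old_pair x'l xl nD' v'w Fx'z; subst a'.
    have e := pa_fun P2 Fx'z (pa_defl P2 Fx'z); subst x'; split=> //.
    by rewrite (pa_free P2 Fxz) !local_map1 // ltW.
  have e := small_ext_new_lower xl nD vw Fxz zx v'w (pa_defr P2 Fx'z); subst v'.
  have Fxx' := pa_comp P2 Fxz (pa_inv P2 Fx'z).
  have e1 := small_ext_old_pair xl x'l nD vw Fxx'; rewrite e1 in Fxx'.
  have e := pa_fun P2 Fxx' (pa_defl P2 Fxx'); subst x'; split=> //.
  by rewrite (pa_free2 P2 Fxz Fx'z).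
- move=> w z z' x b [xl nD [v [a [vw Fxz ->]]]] [_ _ [v' [a' [v'w Fxz' eb]]]].
  have [e | vv'] := eqVneq v v'.
    subst v'; move/(local_map_inj (ltW vw)): eb => e; subst a'.
    exact: (pa_fun P2) Fxz Fxz'.
  have [e e'] := local_map_disjoint vw v'w vv' eb; subst a a'.
  by rewrite (pa_fun P2 Fxz (pa_defl P2 Fxz)) (pa_fun P2 Fxz' (pa_defl P2
      Fxz')).
- move=> v' w z y x a' b v'w [xl nD [v [a [vw Fxz ->]]]] Fzy; split=> //.
  have [e | zx] := eqVneq z x.
    subst z; exists v', a'; split=> //.
    by rewrite (pa_free P2 Fxz) local_map1 ?mulg1 // ltW.
  have e := small_ext_new_lower xl nD vw Fxz zx v'w (pa_defl P2 Fzy); subst v'.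
  exists v, (a' * a); split=> //; first exact: (pa_comp P2) Fxz Fzy.
  by rewrite local_mapM // ltW.
- move=> w z x b [xl nD [v [a [vw Fxz _]]]].
  by rewrite -(pa_def_move P2 (ltW vw) Fxz).
- move=> u u' t z x x' b b' [xl nD [v [a [vu Fxz _]]]].
  move=> [x'l nD' [v' [a' [v'u' Fx'z _]]]].
  rewrite !le_eqVlt => /predU1P[e | tu] /predU1P[e' | tu'].
  + by left; rewrite -e -e'.
  + by subst t; case: (no_long_chain gQ vu tu').
  + by subst t; case: (no_long_chain gQ v'u' tu).
  have [-> | uu'] := eqVneq u u'; [by left | right].
  have [zl | zl] := boolP (z.1 < l)%N.
    by apply: small_ext_small => //; apply/existsP; exists u.
  have zx : z != x by apply: contraNneq zl => ->.
  have zx' : z != x' by apply: contraNneq zl => ->.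
  have [c [_ vc cu Dc]] := small_ext_new_point xl nD vu Fxz zx.
  have [c' [_ v'c' c'u' Dc']] := small_ext_new_point x'l nD' v'u' Fx'z zx'.
  have v'c : (v' <= c)%O by apply/Dc/Dc'.
  have cc' : c = c'.
    by apply/eqP; rewrite eq_le; apply/andP; split;
      [apply/Dc'/Dc | apply/Dc/Dc'].
  subst c'.
  suff : t = v \/ t = v' by case=> ->; apply/Dc.
  have [e | vv'] := eqVneq v v'.
    by subst v'; left; apply: (common_lower_unique gQ hQ k6 uu').
  have [? | tv] := eqVneq t v; first by left.
  have [? | tv'] := eqVneq t v'; first by right.
  case/eqP: uu'.
  move: vc v'c; rewrite !le_eqVlt => /predU1P[e | vc] /predU1P[e' | v'c].
  + by rewrite e e' eqxx in vv'.
  + by subst v; case: (no_long_chain gQ v'c vu).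
  + by subst v'; case: (no_long_chain gQ vc v'u').
  apply: (hexagon gQ hQ k6 _ _ _ _ tu tu' vu v'u' vc v'c);
    by rewrite eq_sym.
- by move=> w z x b [_ _ [v [a [_ /(pa_inv P2)/S2]]]].
Qed.

Definition full_ext : partial_action A := extension small_ext l.+2
    isolated_chart.

Let P3 : free_partial_action full_ext := extension_ok gQ P2 S2 isolated_chartP.
Let S3 : supported full_ext l.+3 := extension_supported S2 isolated_chartP.

Lemma full_ext_complete x u : (x.1 < l)%N -> defined_at full_ext x u.
Proof.
move=> xl; have [D | nD] := pselect (defined_at small_ext x u).
  exact: extension_extends D.
apply/(extension_old small_ext isolated_chart _ (leqW (leqW xl))); right.
have [/existsP[v vu] | su] := big_or_small gQ u; last first.
  by case: nD; apply: small_ext_small.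
exists u, x, (local_map u (1 : A v)); split=> //; split=> //.
exists v, 1; split=> //; apply: small_ext_small => //; by apply/existsP;
  exists u.
Qed.

(** A point [x] born in the first two enlargements, in an orbit of [c], may have
    been taken by the third one into orbits of several [w]; each of these shares
    with [c] the lower bound through which [x] was reached. *)
Lemma full_ext_admissible x : admissible (defined_at full_ext x).
Proof.
have all (S : Q -> Prop) : (forall u, S u) -> admissible S.
  by move=> H; split=> [w v1 v2 nS | v w w' v1 v2 nS]; case: (nS (H _)).
have none (S : Q -> Prop) : (forall u, ~ S u) -> admissible S.
  by move=> H; split=> [w v1 v2 _ _ _ /H | v w w' v1 v2 _ _ _ _ _ /H].
have [xl | xl] := ltnP x.1 l; first by apply: all => u;
    apply: full_ext_complete.
have [xl2 | ] := ltnP x.1 l.+2; last first.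
  rewrite leq_eqVlt => /predU1P[xl2 | xl2]; last first.
    by apply: none => u /S3; rewrite ltnNge xl2.
  case: (extension_fresh S2 isolated_chartP (esym xl2)) => [n | [c Dc]].
    exact: none.
  apply: (star_shaped_admissible gQ hQ k6).
  exists c, (fun _ => False); split=> // u; rewrite Dc.
  by split; [left | case=> // -[w []]].
have E u := extension_old small_ext isolated_chart u xl2.
case: (small_ext_born xl) => [n | [c Dc]].
  apply: none => u /E[/n // | [w [r [b [_ [_ _ [v [a [_ /(pa_defr
    P2)/n]]]]]]]]].
  by [].
apply: (star_shaped_admissible gQ hQ k6).
exists c, (fun w => exists r (b : A w), isolated_chart x r b); split.
  by move=> w [r [b [_ _ [v [a [vw /(pa_defr P2)/Dc vc _]]]]]]; exists v.
move=> u; rewrite E Dc; split; case; try by left.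
  by move=> [w [r [b [uw cx]]]]; right; exists w; split=> //; exists r, b.
by move=> [w [[r [b cx]] uw]]; right; exists w, r, b.
Qed.

Lemma completion : exists F', [/\ stage F' l.+3, extends F F'
  & forall x u, (x.1 < l)%N -> defined_at F' x u].
Proof.
exists full_ext; split; first by split=> //; apply: full_ext_admissible.
  by move=> u a x y Fxy; do 3!apply: extension_extends.
by move=> x u; apply: full_ext_complete.
Qed.

End Completion.
End Layer.

(** * The limit action *)

Section Limit.
Local Open Scope group_scope.
Variables (d : Order.disp_t) (Q : finPOrderType d) (A : complex_of_groups Q).
Hypothesis gQ : graphical_poset Q.
Variable k : nat.
Hypothesis k6 : (6 <= k)%N.
Hypothesis hQ : huge Q k.

Definition stages := {p : partial_action A * nat | @stage _ _ A p.1 p.2}.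

Lemma stage_empty : @stage _ _ A (fun _ _ _ _ => False : Prop) 1.
Proof.
split=> [|u a x y []|x]; first by split=> // u x a [].
by split=> [w v1 v2 _ _ _ []|v w w' v1 v2 _ _ _ _ _ []].
Qed.

Definition first_stage : stages :=
  exist _ ((fun _ _ _ _ => False) : partial_action A, 1%N) stage_empty.

Lemma next_stage_exists (s : stages) : exists s' : stages,
  [/\ (sval s').2 = (sval s).2.+3, extends (sval s).1 (sval s').1
    & forall x u, (x.1 < (sval s).2)%N -> defined_at (sval s').1 x u].
Proof.
case: s => [[F l] FS]; have [F' [FS' ext D]] := completion gQ k6 hQ FS.
by exists (exist _ (F', l.+3) FS').
Qed.

Definition next_stage s : stages := sval (cid (next_stage_exists s)).

Definition nth_stage n := iter n next_stage first_stage.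

(** A point born at time [n] is completed by the round that follows stage [n]. *)
Lemma total_action_exists : exists F : partial_action A,
  free_partial_action F /\ forall x u, defined_at F x u.
Proof.
pose F n := (sval (nth_stage n)).1.
have FP n : free_partial_action (F n) := stage_action (svalP (nth_stage n)).
have [ltF [extF totF]] : (forall n, (n < (sval (nth_stage n)).2)%N) /\
    (forall n, extends (F n) (F n.+1)) /\
    (forall n x u, (x.1 < (sval (nth_stage n)).2)%N -> defined_at (F n.+1) x u).
  split; last by split=> n; rewrite /F /nth_stage iterS /next_stage;
    case: cid => s' [].
  elim=> // n IH; rewrite /nth_stage iterS /next_stage.
  by case: cid => s' /= [-> _ _]; rewrite !ltnS (leqW (ltnW IH)).
have monoF n m u (a : A u) x y : (n <= m)%N -> F n u a x y -> F m u a x y.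
  move=> /subnK <-; elim: (m - n)%N => // i IH /IH; exact: extF.
have liftF n m : (n <= maxn n m /\ m <= maxn n m)%N.
  by rewrite leq_maxl leq_maxr.
exists (fun u a x y => exists n, F n u a x y); split; last first.
  by move=> x u; exists x.1.+1; apply: totF (ltF _).
split.
- move=> u a x y y' [n Fn] [m Fm]; have [nl ml] := liftF n m.
  exact: (pa_fun (FP (maxn n m))) (monoF _ _ _ _ _ _ nl Fn)
    (monoF _ _ _ _ _ _ ml Fm).
- move=> u a b x y z [n Fn] [m Fm]; have [nl ml] := liftF n m;
    exists (maxn n m).
  exact: (pa_comp (FP (maxn n m))) (monoF _ _ _ _ _ _ nl Fn)
    (monoF _ _ _ _ _ _ ml Fm).
- by move=> u a x y [n /(pa_inv (FP n)) Fn]; exists n.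
- by move=> u x a [n /(pa_total (FP n) a)[y Fy]]; exists y, n.
- by move=> u a x [n /(pa_free (FP n))].
- by move=> u w a x y uw [n /(pa_compat (FP n) uw) Fn]; exists n.
Qed.

End Limit.

(** * The group of bijections of a set *)

Section Bijections.
Variable T : Type.

Record bijection := Bijection {
  bij_fun :> T -> T;
  bij_inv : T -> T;
  bij_funK : cancel bij_fun bij_inv;
  bij_invK : cancel bij_inv bij_fun
}.

HB.instance Definition _ := gen_eqMixin bijection.
HB.instance Definition _ := gen_choiceMixin bijection.

Lemma bijection_eq (f g : bijection) : f =1 g -> f = g.
Proof.
case: f g => [f f' fK f'K] [g g' gK g'K] /= /funext E; subst g.
have E : f' = g' by apply/funext => x; rewrite -{1}(g'K x) fK.
by subst g'; congr Bijection; apply: Prop_irrelevance.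
Qed.

Definition bij_one : bijection := @Bijection id id (frefl _) (frefl _).
Definition bij_opp (f : bijection) : bijection :=
  Bijection (bij_invK f) (bij_funK f).
Definition bij_mul (f g : bijection) : bijection :=
  Bijection (can_comp (bij_funK f) (bij_funK g))
    (can_comp (bij_invK g) (bij_invK f)).

Lemma bij_mulA : associative bij_mul.
Proof. by move=> f g h; apply: bijection_eq. Qed.
Lemma bij_mul1 : left_id bij_one bij_mul.
Proof. by move=> f; apply: bijection_eq. Qed.
Lemma bij_mulr1 : right_id bij_one bij_mul.
Proof. by move=> f; apply: bijection_eq. Qed.
Lemma bij_mulV : left_inverse bij_one bij_opp bij_mul.
Proof. by move=> f; apply: bijection_eq => x; apply: bij_funK. Qed.
Lemma bij_mulrV : right_inverse bij_one bij_opp bij_mul.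
Proof. by move=> f; apply: bijection_eq => x; apply: bij_invK. Qed.

HB.instance Definition _ :=
  isGroup.Build bijection bij_mulA bij_mul1 bij_mulr1 bij_mulV bij_mulrV.

End Bijections.

(** * Developability and pieces *)

Section Developability.
Local Open Scope group_scope.
Variables (d : Order.disp_t) (Q : finPOrderType d) (A : complex_of_groups Q).
Variable G : fundamental_group A.

Section Permutations.
Variable F : partial_action A.
Hypothesis FP : free_partial_action F.
Hypothesis Ft : forall x u, defined_at F x u.

Definition act u (a : A u) x : point := sval (cid (pa_total FP a (Ft x u))).

Lemma actP u (a : A u) x : F a x (act a x).
Proof. by rewrite /act; case: cid. Qed.

Lemma act_eq u (a : A u) x y : F a x y -> act a x = y.
Proof. exact: pa_fun FP _ _ _ _ _ (actP a x). Qed.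

Lemma actM u (a b : A u) x : act (a * b) x = act a (act b x).
Proof. by apply: act_eq; apply: (pa_comp FP); apply: actP. Qed.

Lemma act1 u x : act (1 : A u) x = x.
Proof. exact/act_eq/Ft. Qed.

Lemma actK u (a : A u) : cancel (act a) (act a^-1).
Proof. by move=> x; rewrite -actM mulVg act1. Qed.

Lemma actVK u (a : A u) : cancel (act a^-1) (act a).
Proof. by move=> x; rewrite -actM mulgV act1. Qed.

Definition act_bij u (a : A u) : bijection point := Bijection (actK a) (actVK
    a).

Lemma act_bijM u : {morph @act_bij u : a b / a * b}.
Proof. by move=> a b; apply: bijection_eq => x; rewrite /= actM. Qed.

HB.instance Definition _ u :=
  isMultiplicative.Build (A u) (bijection point) (@act_bij u) (@act_bijM u).

(** The universal property turns the action into a morphism to the group of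
    bijections of the points, and the local groups act freely. *)
Lemma fg_in_inj_of_action u : injective (fg_in G u).
Proof.
have [|h [hE _]] := @fg_universal _ _ _ G (bijection point)
    (fun u => @act_bij u : {multiplicative A u -> bijection point}).
  move=> v w vw a; apply: bijection_eq => x /=; symmetry; apply: act_eq.
  by apply: (pa_compat FP (ltW vw)); rewrite (local_map_lt vw); apply: actP.
move=> a b /(congr1 h); rewrite !hE => /(congr1 (fun f : bijection point =>
  f (0, 0))).
move=> /= e; apply: (pa_free2 FP (actP a (0,0))); rewrite e; exact: actP.
Qed.

End Permutations.

Hypothesis gQ : graphical_poset Q.
Variable k : nat.
Hypothesis k6 : (6 <= k)%N.
Hypothesis hQ : huge Q k.

Lemma fg_in_inj u : injective (fg_in G u).
Proof.
have [F [FP Ft]] := total_action_exists A gQ k6 hQ.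
exact: fg_in_inj_of_action FP Ft u.
Qed.

(** Disjointness of the local groups below [w] inside that of [w] passes to the
    fundamental group because the group of [w] injects. *)
Lemma in_local_disjoint v1 v2 w g : (v1 < w)%O -> (v2 < w)%O -> v1 != v2 ->
  in_local v1 g -> in_local v2 g -> g = 1 :> G.
Proof.
move=> v1w v2w v12 [a <-] [b].
rewrite -(fg_compat G v1w) -(fg_compat G v2w) => /fg_in_inj e.
have [|-> _] := @local_map_disjoint _ _ A v1 v2 w a b v1w v2w v12.
  by rewrite (local_map_lt v1w) (local_map_lt v2w).
by rewrite fg_compat fg_in1.
Qed.

Lemma linked_in_local x y (g h : G) : linked x y ->
  bc_class g x = bc_class h x -> in_local x (g^-1 * h).
Proof.
move=> xy /bc_classP/(bc_vertex_eqE _ _ _ _)[] //.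
by case/orP: xy => xy; apply/orP; [right | left]; apply/existsP; exists y.
Qed.

(** An interior vertex of a piece is small, since [g^-1 * h] lies in the groups
    of its two neighbours; but one of two adjacent vertices is big. *)
Lemma piece_short l (p : path_graph l -> gc_base (basic_construction G)) :
  piece p -> (l <= 2)%N.
Proof.
move=> [[homp locp] [g [h [q [q' [homq homq' qE q'E noiso]]]]]].
rewrite leqNgt; apply/negP => l3.
have qq' t : q t = q' t.
  by have := qE t; rewrite -(q'E t); apply: bc_class_inj.
pose o i : 'I_l.+1 := inord i.
have oE i : (i <= l)%N -> o i = i :> nat by move=> il; rewrite inordK.
have adj i : (i < l)%N -> @path_adj l (o i) (o i.+1).
  by move=> il; left; rewrite !oE // ltnW.
have loc t u : @path_adj l t u -> in_local (q t) (g^-1 * h).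
  move=> tu; apply: (linked_in_local (y := q u)); first exact: homq.
  by have := qE t; rewrite -(q'E t) -qq'.
have center t u u' : @path_adj l u t -> @path_adj l t u' -> u <> u' ->
    small (q t).
  move=> ut tu' uu'; have [// | nsq] := boolP (small (q t : Q)).
  have lt_t x : linked (q t) x -> (x < q t)%O.
    by move=> /orP[tx | //]; case: (negP nsq); apply/existsP; exists x.
  have lu : linked (q t) (q u) by apply: homq; apply: path_adj_sym.
  have lu' : linked (q t) (q u') by apply: homq.
  have quu' : q u != q u'.
    apply/eqP => e; apply: uu'; apply: (locp t) => //.
      exact: path_adj_sym.
    by rewrite -!qE e.
  have /(canRL (mulKVg _)) := in_local_disjoint (lt_t _ lu) (lt_t _ lu') quu'
    (loc _ _ ut) (loc _ _ (path_adj_sym tu')).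
  rewrite mulg1 => egh; case: noiso; subst h; exists id; split=> //.
  by split=> //; exists id.
have ne i j : (i <= l)%N -> (j <= l)%N -> i <> j -> o i <> o j.
  by move=> il jl ij /(congr1 (@nat_of_ord l.+1)); rewrite !oE.
have l2 : (1 < l)%N := ltnW l3.
have l1 : (0 < l)%N := ltnW l2.
have s1 : small (q (o 1%N)).
  by apply: (center _ (o 0%N) (o 2)); [exact: adj | exact: adj | exact: ne].
have s2 : small (q (o 2)).
  by apply: (center _ (o 1%N) (o 3)); [exact: adj | exact: adj | exact: ne].
have := linked_small gQ (homq _ _ (adj 1%N l2)) s1.
by rewrite s2.
Qed.

End Developability.

Theorem theorem1p4 (d : Order.disp_t) (Q : finPOrderType d) (k : nat)
    (A : complex_of_groups Q) (G : fundamental_group A) :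
  graphical_poset Q -> 6 <= k -> huge Q k ->
  C_condition k (basic_construction G).
Proof.
move=> gQ k6 hQ n c [homc injc] [g [ci [homci ciE]]]
  [m [mk [s [ls [szls sumls pc]]]]].
have eci : embedded_cycle (ci : cycle_graph n -> order_graph Q).
  by split=> // i j e; apply: injc; rewrite -!ciE e.
have long : k.*2 <= n.+3.
  by apply: leq_trans (card_small_cycle gQ eci); rewrite leq_double; apply: hQ.
have short : sumn ls <= m.*2.
  have H j : j < size ls -> nth 0 ls j <= 2.
    by rewrite szls => /pc/(piece_short gQ k6 hQ).
  rewrite -szls; elim: (ls) H => //= l t IH H; rewrite doubleS -add2n.
  by apply: leq_add; [exact: (H 0) | apply: IH => j jt; apply: (H j.+1)].
by rewrite sumls leqNgt (leq_trans _ long) // ltn_double in short.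
Qed.
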